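(* Let $4.2$ denote the $3$-graph on $4$ vertices with exactly $2$ edges (unique up to isomorphism). Then $\pi_{4.2}(\emptyset)=3/4$; that is, the limit as $n\to\infty$ of the maximum, over all $3$-graphs $G$ on $n$ vertices, of the number of $4$-element vertex subsets of $G$ spanning exactly two edges, divided by $\binom{n}{4}$, equals $3/4$.
   Context: A $3$-graph is a pair $G=(V,E)$ with $E$ a set of $3$-element subsets of $V$. For a $3$-graph $H$ on $h$ vertices and a $3$-graph $G$ on $n\ge h$ vertices, $e_H(G)$ is the number of $h$-subsets of $V(G)$ inducing a copy of $H$. $\pi_H(\emptyset)=\lim_{n\to\infty}\max\{e_H(G): |V(G)|=n\}/\binom{n}{h}$ (the inducibility of $H$; the limit exists). *)

(* Defs.v *)
From HB Require Import structures.
From mathcomp Require Import all_boot all_order all_algebra.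

Set Implicit Arguments.
Unset Strict Implicit.
Unset Printing Implicit Defensive.

Record tgraph (V : finType) := TGraph {
  edges : {set {set V}};
  edgesP : [forall e in edges, #|e| == 3]
}.

HB.instance Definition _ (V : finType) := [isSub for @edges V].
HB.instance Definition _ (V : finType) := [Finite of tgraph V by <:].

(* [f] ranges over bijections from the vertices of [H] onto [S]; the edges of
   [G] contained in [S] are exactly the images of the edges of [H]. *)
Definition induces_copy (U V : finType) (H : tgraph U) (G : tgraph V)
    (S : {set V}) : bool :=
  [exists f : {ffun U -> V},
    [&& injectiveb f, f @: [set: U] == S
      & [forall e : {set U}, (e \in edges H) == (f @: e \in edges G)]]].

Definition copies (U V : finType) (H : tgraph U) (G : tgraph V) : nat :=
  #|[set S : {set V} | (#|S| == #|U|) && induces_copy H G S]|.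

Definition max_copies (U : finType) (H : tgraph U) (n : nat) : nat :=
  \max_(G : tgraph 'I_n) copies H G.

Definition o4 (i : nat) : 'I_4 := inord i.

Definition edges42 : {set {set 'I_4}} :=
  [set [set o4 0; o4 1; o4 2]; [set o4 0; o4 1; o4 3]].

Lemma edges42P : [forall e in edges42, #|e| == 3].
Proof.
apply/forall_inP => e; rewrite !inE => /orP[] /eqP->;
  by rewrite -setUA !cardsU1 !inE cards1 -!val_eqE /= !inordK.
Qed.

Definition graph42 : tgraph 'I_4 := TGraph edges42P.

Definition spanned_edges (V : finType) (G : tgraph V) (S : {set V}) : nat :=
  #|[set e in edges G | e \subset S]|.

Definition two_edge_sets (V : finType) (G : tgraph V) : nat :=
  #|[set S : {set V} | (#|S| == 4) && (spanned_edges G S == 2)]|.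

Definition max_two_edge_sets (n : nat) : nat :=
  \max_(G : tgraph 'I_n) two_edge_sets G.

From mathcomp Require Import all_classical all_reals all_analysis.
Import Order.TTheory GRing.Theory Num.Theory.
Import numFieldNormedType.Exports.

(* The terms with [n < #|U|] have a zero denominator and are equal to 0. *)
Definition copy_density (R : realType) (U : finType) (H : tgraph U) (n : nat)
    : R :=
  ((max_copies H n)%:R / ('C(n, #|U|))%:R)%R.

(* The number pi_H(emptyset); meaningful only when the sequence converges. *)
Definition inducibility (R : realType) (U : finType) (H : tgraph U) : R :=
  limn (copy_density R H).

(* Main.v *)
(** Give a triple [T] the sign [x_T = -1] if it is an edge and [1] otherwise.
    If a 4-set [S] spans [k] edges, the sum [s] of its four signs is [4 - 2k],
    so that [16 [k = 2] <= 16 - s^2], with equality when [k] is even.  Expanding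
    [s^2] leaves [4] plus the products [x_T x_T'] over ordered pairs of distinct
    triples of [S]; such triples share exactly a pair [P].

    Upper bound: summed over all 4-sets, these products give
    [sum_P ((sum_u x_(P + u))^2 - (n - 2)) >= - 'C(n, 2) (n - 2)], hence at most
    [3/4 'C(n, 4) + O(n^3)] of the 4-sets span two edges.

    Lower bound: colour the pairs at random and take as edges the triples that
    contain an odd number of coloured pairs (a random two-graph).  Every 4-set
    then spans an even number of edges, and [x_T x_T'] averages to zero because
    recolouring a pair contained in [T] but not in [T'] changes its sign.  The
    expected number of 4-sets spanning two edges is therefore exactly
    [3/4 'C(n, 4)]. *)

Require Import Defs.
From HB Require Import structures.
From mathcomp Require Import all_boot all_order all_algebra.
From mathcomp Require Import zify.
Import Order.TTheory GRing.Theory Num.Theory.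

Set Implicit Arguments.
Unset Strict Implicit.
Unset Printing Implicit Defensive.

(** * Signs of the triples of a 4-set *)

Lemma sum_sqr_expand (R : comPzRingType) (T : finType) (A : {set T})
    (f : T -> R) :
  ((\sum_(u in A) f u) ^+ 2 =
   \sum_(u in A) f u ^+ 2 + \sum_(u in A) \sum_(v in A | v != u) f u * f v)%R.
Proof.
rewrite expr2 mulr_suml -big_split /=; apply: eq_bigr => u uA.
by rewrite (bigD1 u) //= mulrDr mulr_sumr expr2.
Qed.

Definition esign (V : finType) (E : {set {set V}}) (T : {set V}) : int :=
  ((-1) ^+ (T \in E))%R.

Lemma esign_sqr (V : finType) (E : {set {set V}}) (T : {set V}) :
  (esign E T ^+ 2 = 1)%R.
Proof. by rewrite /esign sqrr_sign. Qed.

(** Each triple of a 4-set [S] is named by the vertex it omits; this is the off-diagonal part of the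
    square of the sum of the four signs. *)
Definition cross (V : finType) (E : {set {set V}}) (S : {set V}) : int :=
  (\sum_(u in S) \sum_(v in S | v != u) esign E (S :\ u) * esign E (S :\ v))%R.

Lemma subset_card_setD1 (V : finType) (e S : {set V}) :
  e \subset S -> #|S| = #|e|.+1 -> exists2 u, u \in S & e = S :\ u.
Proof.
move=> eS cS; have : #|S :\: e| == 1 by rewrite cardsD (setIidPr eS) cS subSnn.
case/cards1P => u Su; exists u.
  by have : u \in S :\: e by [rewrite Su inE]; rewrite inE => /andP[].
by rewrite -Su setDDr setDv set0U (setIidPr eS).
Qed.

Lemma spanned_edgesE (V : finType) (G : tgraph V) (S : {set V}) : #|S| = 4 ->
  spanned_edges G S = #|[set u in S | S :\ u \in edges G]|.
Proof.
move=> S4; rewrite /spanned_edges.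
have inj : {in S &, injective (fun u => S :\ u)}.
  move=> u v uS vS /setP /(_ u); rewrite !inE eqxx uS /= andbT => /esym/negbFE.
  by move/eqP.
rewrite -[RHS](card_in_imset (f := fun u => S :\ u)); last first.
  by move=> u v; rewrite !inE => /andP[uS _] /andP[vS _]; apply: inj.
congr #|pred_of_set _|; apply/setP => e; rewrite inE; apply/andP/imsetP.
  case=> eE eS; have /eqP e3 := forall_inP (edgesP G) e eE.
  have [|u uS eSu] := subset_card_setD1 eS; first by rewrite S4 e3.
  by exists u; rewrite // inE uS -eSu.
by case=> u; rewrite inE => /andP[uS uE] ->; rewrite subD1set.
Qed.

Lemma spanned_edges_le4 (V : finType) (G : tgraph V) (S : {set V}) :
  #|S| = 4 -> spanned_edges G S <= 4.
Proof.
move=> S4; rewrite spanned_edgesE // -S4 subset_leq_card //.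
by apply/subsetP => u; rewrite inE => /andP[].
Qed.

Lemma sum_esign (V : finType) (E : {set {set V}}) (S : {set V}) : #|S| = 4 ->
  (\sum_(u in S) esign E (S :\ u)
    = 4 - 2 * (#|[set u in S | (S :\ u) \in E]|)%:R)%R.
Proof.
move=> S4.
transitivity (\sum_(u in S) (1 - 2 * ((S :\ u) \in E)%:R) : int)%R.
  by apply: eq_bigr => u _; rewrite /esign; case: (_ \in _).
rewrite sumrB sumr_const S4 -mulr_sumr -natr_sum; congr (_ - _ * _%:R)%R.
by rewrite -sum1_card -big_mkcondr; apply: eq_bigl => u; rewrite inE.
Qed.

Lemma sum_esign_sqr (V : finType) (E : {set {set V}}) (S : {set V}) :
  #|S| = 4 -> ((\sum_(u in S) esign E (S :\ u)) ^+ 2 = 4 + cross E S)%R.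
Proof.
move=> S4; rewrite sum_sqr_expand (eq_bigr (fun=> 1%R)) ?sumr_const ?S4 //.
by move=> u _; rewrite esign_sqr.
Qed.

(** For k = 0, ..., 4 spanned edges the right side is 16 - (4 - 2k)^2 = 0, 12, 16, 12, 0, so only
    odd k loses anything. *)
Lemma two_edges_le_cross (V : finType) (G : tgraph V) (S : {set V}) :
  #|S| = 4 -> (16 * (spanned_edges G S == 2)%:R <= 12 - cross (edges G) S)%R.
Proof.
move=> S4; have := sum_esign_sqr (edges G) S4.
rewrite sum_esign // -spanned_edgesE //.
have := spanned_edges_le4 G S4.
by case: (spanned_edges G S) => [|[|[|[|[|k]]]]] //= _ H; lia.
Qed.

Lemma two_edges_eq_cross (V : finType) (G : tgraph V) (S : {set V}) :
  #|S| = 4 -> ~~ odd (spanned_edges G S) ->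
  (16 * (spanned_edges G S == 2)%:R = 12 - cross (edges G) S)%R.
Proof.
move=> S4; have := sum_esign_sqr (edges G) S4.
rewrite sum_esign // -spanned_edgesE //.
have := spanned_edges_le4 G S4.
by case: (spanned_edges G S) => [|[|[|[|[|k]]]]] //= _ H _; lia.
Qed.

(** * Upper bound by double counting over pairs *)

Lemma two_edge_setsE (V : finType) (G : tgraph V) :
  two_edge_sets G = \sum_(S : {set V} | #|S| == 4) (spanned_edges G S == 2).
Proof.
rewrite /two_edge_sets -sum1_card -big_mkcondr.
by apply: eq_bigl => S; rewrite inE.
Qed.

(** The triples of [S] omitting [u] and [v] meet in the pair [P = S :\ u :\ v], and [S] is recovered
    as [u |: (v |: P)]. *)
Lemma sum_cross (V : finType) (E : {set {set V}}) :
  (\sum_(S : {set V} | #|S| == 4) cross E S =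
   \sum_(P : {set V} | #|P| == 2) \sum_(u in ~: P) \sum_(v in ~: P | v != u)
     esign E (u |: P) * esign E (v |: P))%R.
Proof.
rewrite /cross (exchange_big_dep predT) //= [RHS](exchange_big_dep predT) //=.
apply: eq_bigr => u _.
rewrite (exchange_big_dep (fun v => v != u)) /=; last by move=> S v _ /andP[].
rewrite [RHS](exchange_big_dep (fun v => v != u)) /=;
  last by move=> S v _ /andP[].
apply: eq_bigr => v vu.
rewrite (reindex_onto (fun P => u |: (v |: P))
  (fun S => S :\ u :\ v)) /=; last first.
  move=> S /andP[/andP[_ uS] /andP[vS _]].
  by rewrite (setD1K (a := v)) ?setD1K // !inE vu.
have notinK (P : {set V}) :
    (u |: (v |: P)) :\ u :\ v == P = (u \notin P) && (v \notin P).
  apply/eqP/andP => [<-|[uP vP]]; first by rewrite !inE !eqxx ?andbF.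
  by rewrite setU1K ?setU1K // !inE negb_or eq_sym vu.
apply: eq_big => P.
  rewrite notinK !inE !eqxx vu !orbT /=.
  case uP: (u \in P); first by rewrite !andbF.
  case vP: (v \in P); first by rewrite !andbF.
  by rewrite !cardsU1 !inE (eq_sym u) (negbTE vu) uP vP !andbT.
rewrite notinK => /andP[_ /andP[uP vP]].
(* Omitting [u] leaves [v |: P] and conversely, so the factors come out swapped. *)
rewrite mulrC setU1K; last by rewrite !inE negb_or eq_sym vu.
by rewrite setUCA setU1K // !inE negb_or vu.
Qed.

(** For each pair the inner double sum is a square minus its [#|V| - 2] diagonal terms, all equal to
    1. Truncated subtraction does no harm: when [#|V| < 2] there are no pairs. *)
Lemma sum_cross_ge (V : finType) (E : {set {set V}}) :
  (- ('C(#|V|, 2) * (#|V| - 2))%:R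
     <= \sum_(S : {set V} | #|S| == 4) cross E S)%R.
Proof.
rewrite sum_cross.
have -> : (- ('C(#|V|, 2) * (#|V| - 2))%:R =
    \sum_(P : {set V} | #|P| == 2%N) - (#|V| - 2)%:R :> int)%R.
  rewrite -card_draws sumr_const natrM mulr_natl mulNrn.
  by congr (- (_ *+ _))%R; apply: eq_card => P; rewrite inE.
apply: ler_sum => P /eqP P2.
have := sum_sqr_expand (~: P) (fun u => esign E (u |: P)).
rewrite [X in _ = (X + _)%R](eq_bigr (fun=> 1%R)); last by move=> u _; rewrite esign_sqr.
rewrite sumr_const cardsCs setCK P2 => H.
by rewrite -subr_ge0 opprK addrC -H sqr_ge0.
Qed.

Lemma two_edge_sets_le (V : finType) (G : tgraph V) :
  16 * two_edge_sets G <= 12 * 'C(#|V|, 4) + 'C(#|V|, 2) * (#|V| - 2).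
Proof.
rewrite -(ler_nat int) natrD natrM two_edge_setsE natr_sum mulr_sumr.
apply: (@le_trans _ _
  (\sum_(S : {set V} | #|S| == 4) (12 - cross (edges G) S))%R).
  by apply: ler_sum => S /eqP; apply: two_edges_le_cross.
rewrite sumrB lerD //; last by rewrite lerNl sum_cross_ge.
rewrite sumr_const -card_draws natrM mulr_natr le_eqVlt; apply/orP; left.
by apply/eqP; congr (_ *+ _)%R; apply: eq_card => P; rewrite inE.
Qed.

(** * Lower bound by averaging over two-graphs *)

Section TwoGraph.
Context (V : finType).

(** A colouring is an arbitrary family [c] of which only the pairs count; every colouring of the
    pairs comes from equally many [c], so a uniform [c] is a random colouring. *)
Definition two_graph_edges (c : {set {set V}}) : {set {set V}} :=
  [set T : {set V} | (#|T| == 3) &&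
     odd #|[set p in c | (#|p| == 2) && (p \subset T)]|].

Lemma two_graph_edgesP c : [forall e in two_graph_edges c, #|e| == 3].
Proof. by apply/forall_inP => e; rewrite inE => /andP[]. Qed.

Definition two_graph c : tgraph V := TGraph (two_graph_edgesP c).

Lemma esign_two_graph c (T : {set V}) : #|T| = 3 ->
  (esign (two_graph_edges c) T =
   \prod_(p : {set V} | (#|p| == 2%N) && (p \subset T)) (-1) ^+ (p \in c))%R.
Proof.
move=> T3; rewrite /esign inE T3 eqxx /= signr_odd -sum1_card -prodrXr.
rewrite [RHS](eq_bigr (fun p => if p \in c then (-1) else 1)%R);
  last by move=> p _; case: (p \in c).
rewrite -big_mkcondr; apply: eq_bigl => p; by rewrite !inE andbC.
Qed.

Lemma card_setD1_4 (S : {set V}) u : #|S| = 4 -> u \in S -> #|S :\ u| = 3.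
Proof. by move=> S4 uS; have := cardsD1 u S; rewrite S4 uS => -[]. Qed.

(* Every pair in [S] lies in exactly two of its triples, so the product of the
   four signs is 1. *)
Lemma two_graph_even c (S : {set V}) :
  #|S| = 4 -> ~~ odd (spanned_edges (two_graph c) S).
Proof.
move=> S4; rewrite spanned_edgesE //.
have : (\prod_(u in S) esign (two_graph_edges c) (S :\ u) = 1)%R.
  rewrite (eq_bigr (fun u => \prod_(p : {set V} |
      (#|p| == 2%N) && (p \subset S :\ u)) (-1) ^+ (p \in c))%R);
    last by move=> u uS; rewrite esign_two_graph // card_setD1_4.
  rewrite (exchange_big_dep
    (fun p : {set V} => (#|p| == 2%N) && (p \subset S))) /=; last first.
    move=> u p uS /andP[-> /subset_trans]; apply; exact: subD1set.
  rewrite big1 // => p /andP[p2 pS].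
  rewrite (eq_bigl (mem (S :\: p))); last first.
    by move=> u; rewrite p2 subsetD1 pS !inE andbC.
  by rewrite prodr_const cardsD (setIidPr pS) S4 (eqP p2) sqrr_sign.
rewrite /esign prodrXr -big_mkcondr /=.
have -> : \sum_(u in S | (S :\ u) \in two_graph_edges c) 1 =
    #|[set u in S | S :\ u \in two_graph_edges c]|.
  by rewrite -sum1_card; apply: eq_bigl => u; rewrite inE.
by rewrite -signr_odd; case: odd.
Qed.

Definition toggle (p : {set V}) (c : {set {set V}}) : {set {set V}} :=
  [set q | (q \in c) (+) (q == p)].

Lemma toggleK p : involutive (toggle p).
Proof. by move=> c; apply/setP => q; rewrite !inE -addbA addbb addbF. Qed.

Lemma esign_toggle (p : {set V}) c (T : {set V}) : #|p| = 2 -> #|T| = 3 ->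
  (esign (two_graph_edges (toggle p c)) T =
   (-1) ^+ (p \subset T) * esign (two_graph_edges c) T)%R.
Proof.
move=> p2 T3; rewrite !esign_two_graph //.
have -> : ((-1) ^+ (p \subset T) = \prod_(q : {set V} |
    (#|q| == 2%N) && (q \subset T)) (-1) ^+ (q == p) :> int)%R.
  case: (boolP (p \subset T)) => pT.
    rewrite (bigD1 p) ?p2 ?pT //= eqxx big1 ?mulr1 // => q /andP[_ /negbTE->] //.
  rewrite big1 // => q /andP[_ qT]; case: eqP => // qp.
  by move: pT; rewrite -qp qT.
rewrite -big_split; apply: eq_bigr => q _ /=.
by rewrite inE signr_addb mulrC.
Qed.

Lemma sum_esign_two_graph (S : {set V}) u v :
  #|S| = 4 -> u \in S -> v \in S -> v != u ->
  (\sum_(c : {set {set V}})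
    esign (two_graph_edges c) (S :\ u) * esign (two_graph_edges c) (S :\ v) = 0)%R.
Proof.
move=> S4 uS vS vu.
have [a aS /andP[au av]] : exists2 a, a \in S & (a != u) && (a != v).
  have : 0 < #|S :\ u :\ v|.
    have := cardsD1 v (S :\ u); rewrite card_setD1_4 // !inE vu vS add1n => -[<-] //.
  by case/card_gt0P => a; rewrite !inE => /and3P[av au aS]; exists a; rewrite ?au.
(* With [a] a third vertex of [S], this pair avoids [u] but contains [v], so it lies in exactly one
   of the two triples. *)
set p := [set a; v].
have p2 : #|p| = 2 by rewrite cards2 av.
have pu : p \subset S :\ u.
  by apply/subsetP => w; rewrite !inE => /orP[]/eqP->; rewrite ?au ?aS ?vu ?vS.
have pv : p \subset S :\ v = false.
  by apply/negP => /subsetP /(_ v); rewrite !inE !eqxx orbT /= => /(_ isT).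
set s := (\sum_c _)%R.
(* Reindexing by the involution [toggle p] negates every term. *)
suff : s = (- s)%R by lia.
rewrite {1}/s (reindex_inj (inv_inj (toggleK p))) /= -sumrN.
apply: eq_bigr => c _.
by rewrite !esign_toggle ?card_setD1_4 // pu pv mul1r mulN1r mulNr.
Qed.

Lemma sum_cross_two_graph (S : {set V}) : #|S| = 4 ->
  (\sum_(c : {set {set V}}) cross (two_graph_edges c) S = 0)%R.
Proof.
move=> S4; rewrite /cross exchange_big big1 //= => u uS.
rewrite exchange_big big1 //= => v /andP[vS vu].
exact: sum_esign_two_graph.
Qed.

(** The expectation 3/4 ['C(#|V|, 4)], cleared of denominators by summing a constant over all
    [c]. *)
Lemma sum_two_edge_sets_two_graph :
  \sum_(c : {set {set V}}) 4 * two_edge_sets (two_graph c) =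
  \sum_(c : {set {set V}}) 3 * 'C(#|V|, 4).
Proof.
(* A further factor 4 produces the 16 of [two_edges_eq_cross]. *)
apply/eqP; rewrite -(eqn_pmul2l (isT : 0 < 4)) -(eqr_nat int) !natrM !natr_sum.
rewrite !mulr_sumr; apply/eqP.
transitivity (\sum_(c : {set {set V}}) \sum_(S : {set V} | #|S| == 4%N)
    (12 - cross (two_graph_edges c) S))%R.
  apply: eq_bigr => c _; rewrite natrM mulrA two_edge_setsE natr_sum mulr_sumr.
  apply: eq_bigr => S /eqP S4; rewrite -[(4%:R * 4%:R)%R]/(16%:R : int)%R.
  by apply: (@two_edges_eq_cross _ (two_graph c)) => //; exact: two_graph_even.
rewrite exchange_big [RHS]sumr_const /=.
rewrite (eq_bigr (fun=> \sum_(c : {set {set V}}) 12)%R); last first.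
  by move=> S /eqP S4; rewrite sumrB sum_cross_two_graph // subr0.
rewrite !sumr_const -card_draws natrM mulrA.
rewrite -[(4%:R * 3%:R)%R]/(12%:R : int)%R mulr_natr -!mulrnA.
rewrite [(#|xpredT| * _)%N]mulnC; congr ((_ * (_ * _))%:R)%R.
  by apply: eq_card => S; rewrite inE.
Qed.

Lemma exists_two_edge_sets_ge :
  exists G : tgraph V, 3 * 'C(#|V|, 4) <= 4 * two_edge_sets G.
Proof.
apply/existsP; apply: contraT; rewrite negb_exists => /forallP H.
have: \sum_(c : {set {set V}}) (4 * two_edge_sets (two_graph c) + 1) <=
    \sum_(c : {set {set V}}) 3 * 'C(#|V|, 4).
  by apply: leq_sum => c _; rewrite addn1 ltnNge.
rewrite big_split /= sum_two_edge_sets_two_graph -[leqRHS]addn0 leq_add2l.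
(* The surplus is the number of colourings, which is positive since [set0] is one. *)
by rewrite leqn0 sum1_card => /eqP/card0_eq/(_ set0).
Qed.

End TwoGraph.

(** * Copies of 4.2 as 4-sets spanning two edges *)

Lemma set_ord4_012 : [set o4 0; o4 1; o4 2] = ~: [set o4 3].
Proof.
apply/setP => i; rewrite !inE -!val_eqE /= !inordK //.
by case: i => -[|[|[|[|]]]].
Qed.

Lemma set_ord4_013 : [set o4 0; o4 1; o4 3] = ~: [set o4 2].
Proof.
apply/setP => i; rewrite !inE -!val_eqE /= !inordK //.
by case: i => -[|[|[|[|]]]].
Qed.

Lemma card_edges42 : #|edges42| = 2.
Proof.
rewrite /edges42 set_ord4_012 set_ord4_013 cards2.
case: eqP => // /setC_inj/set1_inj.
by move/(congr1 val); rewrite /= !inordK.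
Qed.

(** A copy carries the two edges bijectively onto those spanned by [S]. Conversely, if the two edges
    in [S] omit [d] and [c], any bijection sending 3 to [d] and 2 to [c] works, because the edges of
    [graph42] omit 3 and 2. *)
Lemma induces_copy42 (V : finType) (G : tgraph V) (S : {set V}) : #|S| = 4 ->
  induces_copy graph42 G S = (spanned_edges G S == 2).
Proof.
move=> S4; apply/existsP/idP.
  case=> f /and3P[/injectiveP f_inj /eqP fS /forallP fE].
  rewrite -card_edges42 -(card_imset _ (imset_inj f_inj)); apply/eqP.
  congr #|pred_of_set _|; apply/setP => e; rewrite inE; apply/andP/imsetP.
    case=> eE eS; have eI : e = f @: (f @^-1: e).
      apply/setP => v; apply/idP/imsetP => [ve|[i]]; last by rewrite inE => ? ->.
      have : v \in f @: [set: 'I_4] by rewrite fS (subsetP eS).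
      by case/imsetP => i _ vi; exists i => //; rewrite inE -vi.
    by exists (f @^-1: e) => //; rewrite (eqP (fE _)) -eI.
  case=> e' e'E ->; rewrite -(eqP (fE _)); split=> //.
  by rewrite -fS imsetS // subsetT.
rewrite spanned_edgesE // => /cards2P [d [c [dc DE]]].
have inD u : u \in [set d; c] -> u \in S /\ S :\ u \in edges G.
  by rewrite -DE inE => /andP.
have [dS dE] := inD d (set21 d c); have [cS cE] := inD c (set22 d c).
have : #|S :\ d :\ c| == 2.
  have := cardsD1 c (S :\ d); have := cardsD1 d S.
  by rewrite !inE S4 dS cS (eq_sym c) dc !add1n => -[<-] [<-].
case/cards2P => a [b [ab abE]].
have [] : a \in S :\ d :\ c /\ b \in S :\ d :\ c by rewrite abE set21 set22.
rewrite !inE => /and3P[ac ad aS] /and3P[bc bd bS].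
pose f : {ffun 'I_4 -> V} := [ffun i : 'I_4 => nth a [:: a; b; c; d] i].
have f_inj : injective f.
  move=> i j; rewrite !ffunE => /eqP; rewrite nth_uniq //=.
    by move/eqP/val_inj.
  by rewrite !inE !negb_or ab ac ad bc bd eq_sym dc.
have fS : f @: [set: 'I_4] = S.
  apply/eqP; rewrite eqEcard card_imset // cardsT card_ord S4 leqnn andbT.
  apply/subsetP => v /imsetP[i _ ->]; rewrite ffunE.
  by case: i => -[|[|[|[|]]]].
have fC i : f @: (~: [set i]) = S :\ f i.
  apply/setP => v; rewrite !inE -fS.
  apply/imsetP/andP => [[j]|[vi /imsetP[j _ vj]]].
    by rewrite !inE => ji ->; rewrite (inj_eq f_inj) imset_f.
  by exists j => //; rewrite !inE; apply: contraNneq vi => <-; rewrite vj.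
have f3 : f (o4 3) = d by rewrite ffunE inordK.
have f2 : f (o4 2) = c by rewrite ffunE inordK.
exists f; apply/and3P; split; [exact/injectiveP | exact/eqP | ].
apply/forallP => e; apply/eqP.
have -> : (e \in edges graph42) = (f @: e \in [set S :\ d; S :\ c]).
  rewrite /= /edges42 set_ord4_012 set_ord4_013 -f3 -f2 -!fC !inE.
  by rewrite !(inj_eq (imset_inj f_inj)).
(* An edge inside [S] omits a single vertex, which must be [d] or [c]. *)
apply/idP/idP; first by rewrite !inE => /orP[] /eqP->.
move=> eE; have /eqP e3 := forall_inP (edgesP G) _ eE.
have eS : f @: e \subset S by rewrite -fS imsetS // subsetT.
have [|u uS eSu] := subset_card_setD1 eS; first by rewrite S4 e3.
have : u \in [set d; c] by rewrite -DE inE uS -eSu.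
by rewrite !inE eSu => /orP[] /eqP->; rewrite eqxx ?orbT.
Qed.

Lemma copies42 (V : finType) (G : tgraph V) : copies graph42 G = two_edge_sets G.
Proof.
rewrite /copies /two_edge_sets card_ord; congr #|pred_of_set _|.
apply/setP => S; rewrite !inE; case: eqP => //= S4.
by rewrite induces_copy42.
Qed.

Lemma max_copies42 n : max_copies graph42 n = max_two_edge_sets n.
Proof. by apply: eq_bigr => G _; rewrite copies42. Qed.

(** * Density bounds and the limit *)

Lemma max_two_edge_sets_ge n : 3 * 'C(n, 4) <= 4 * max_two_edge_sets n.
Proof.
have [G] := exists_two_edge_sets_ge 'I_n; rewrite card_ord => /leq_trans; apply.
by rewrite leq_mul2l; apply/orP; right; exact: leq_bigmax.
Qed.

Lemma max_two_edge_sets_le n :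
  16 * max_two_edge_sets n <= 12 * 'C(n, 4) + 'C(n, 2) * (n - 2).
Proof.
rewrite /max_two_edge_sets.
elim/big_ind: _ => [|x y xn yn|G _]; first by rewrite muln0.
  by rewrite maxnMr geq_max xn.
by have := two_edge_sets_le G; rewrite card_ord.
Qed.

From mathcomp Require Import ring lra.
From mathcomp Require Import all_classical all_reals all_analysis.
Import numFieldNormedType.Exports.
Local Open Scope classical_set_scope.
Local Open Scope ring_scope.

Lemma two_edge_density_bounds (R : realFieldType) (n : nat) :
  3 / 4 <= ((max_two_edge_sets n.+4)%:R / ('C(n.+4, 4))%:R : R)
        <= 3 / 4 + 3 / 4 * n.+1%:R^-1.
Proof.
have C0 : 0 < ('C(n.+4, 4))%:R :> R by rewrite ltr0n bin_gt0.
have lb := max_two_edge_sets_ge n.+4.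
(* With N = n + 4, (N - 2) C(N, 2) = 3 C(N, 3) and (N - 3) C(N, 3) = 4 C(N, 4), so the error term
   times n + 1 = N - 3 is 12 C(N, 4). *)
have ub : (16 * max_two_edge_sets n.+4 * n.+1 <= 12 * 'C(n.+4, 4) * n.+2)%N.
  have := mul_bin_left n.+4 3; have := mul_bin_left n.+4 2.
  rewrite !subSS !subn0 => C3 C4; have := max_two_edge_sets_le n.+4.
  by rewrite !subSS !subn0; nia.
rewrite ler_pdivlMr // ler_pdivrMr //; apply/andP; split.
  by move: lb; rewrite -(ler_nat R) !natrM; lra.
have n0 : 0 < n.+1%:R :> R by rewrite ltr0n.
have -> : 3 / 4 + 3 / 4 * n.+1%:R^-1 = 3 / 4 * n.+2%:R / n.+1%:R :> R.
  by rewrite -[n.+2%:R]natr1; field; rewrite nat1r gt_eqF.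
rewrite mulrAC ler_pdivlMr //.
by move: ub; rewrite -(ler_nat R) !natrM; lra.
Qed.

Theorem theorem2p27 (R : realType) :
  [/\ cvgn (copy_density R graph42),
      inducibility R graph42 = 3 / 4
    & (max_two_edge_sets n)%:R / ('C(n, 4))%:R @[n --> \oo] --> (3 / 4 : R)].
Proof.
have cvg42 :
    (max_two_edge_sets n)%:R / ('C(n, 4))%:R @[n --> \oo] --> (3 / 4 : R).
  (* The shift skips the terms with [n < 4], where the denominator is zero, and leaves the limit
     unchanged. *)
  rewrite -(cvg_shiftn 4) /=.
  apply: (@squeeze_cvgr _ _ _ _ (fun=> 3 / 4)
    (fun n => 3 / 4 + 3 / 4 * n.+1%:R^-1)).
  - by near=> n; rewrite addn4; exact: two_edge_density_bounds.
  - exact: cvg_cst.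
  - rewrite -[X in _ --> X]addr0; apply: cvgD; first exact: cvg_cst.
    rewrite -[X in _ --> X](mulr0 (3 / 4)); apply: cvgMr; exact: cvg_harmonic.
have densityE : copy_density R graph42 =
    fun n => (max_two_edge_sets n)%:R / ('C(n, 4))%:R.
  by apply/funext => n; rewrite /copy_density max_copies42 card_ord.
split => //; rewrite ?/inducibility densityE.
- by apply/cvg_ex; exists (3 / 4).
- exact: cvg_lim cvg42.
Unshelve. all: by end_near.
Qed.
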